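(* Let $M \subseteq \mathbb{N}$ be a numerical semigroup and let $n \in M \setminus \{0\}$. Let $L$ be the list of small elements of $M$. Then for every $x \in \mathbb{N}$, $x$ occurs in the list $\mathrm{apery}_2(L, n)$ if and only if $x \in M$ and ($n \le x$ implies $x - n \notin M$).
   Context: A numerical semigroup is a submonoid $M$ of $(\mathbb{N},+)$ with $\mathbb{N}\setminus M$ finite. Its conductor is $1$ plus the largest element of $\mathbb{N}\setminus M$ if $\mathbb{N}\setminus M$ is non-empty, and $0$ otherwise. The list of small elements of $M$ is the list of the elements of $M$ that are $\le$ the conductor, in ascending order. For a list $L$ of natural numbers and $n, a \in \mathbb{N}$, $\mathrm{findmod}(L,n,a)$ is the first element $x$ of $L$ with $x \equiv a \pmod n$ if such an element exists, and otherwise it is the smallest natural number $x$ greater than the last element of $L$ with $x \equiv a \pmod n$. Then $\mathrm{apery}_2(L,n)$ is the list $[\mathrm{findmod}(L,n,0); \dots; \mathrm{findmod}(L,n,n-1)]$. The set $\{x \in M \mid n \le x \rightarrow x-n \notin M\}$ is the Apéry set of $M$ with respect to $n$. *)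

(* Defs.v *)
From mathcomp Require Import all_boot finmap.
From mathcomp Require Import boolp classical_sets functions cardinality.

Set Implicit Arguments.
Unset Strict Implicit.
Unset Printing Implicit Defensive.

Local Open Scope classical_set_scope.
Local Open Scope nat_scope.

Definition numerical_semigroup (M : set nat) : Prop :=
  [/\ M 0, forall x y : nat, M x -> M y -> M (x + y) & finite_set (~` M)].

(* [fset_set A] is the finite set with the elements of [A] when [A] is finite
   (and is empty otherwise, a case excluded for numerical semigroups). *)
Definition gaps (M : set nat) : {fset nat} := fset_set (~` M).

Definition conductor (M : set nat) : nat :=
  if gaps M == fset0 then 0 else (\max_(g <- gaps M) g).+1.

Definition small_elements (M : set nat) : seq nat :=
  [seq x <- iota 0 (conductor M).+1 | x \in M].

(* The default value 0 is returned when no natural number satisfies [P]. *)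
Definition least_nat (P : pred nat) : nat :=
  if pselect (exists x, P x) is left exP then ex_minn exP else 0.

(* For [L = [::]], which has no last element, [last 0 L] is 0; the list of
   small elements of a numerical semigroup is never empty, as it contains 0. *)
Definition findmod (L : seq nat) (n a : nat) : nat :=
  let p := fun x : nat => x == a %[mod n] in
  if has p L then nth 0 L (find p L)
  else least_nat (fun x => (last 0 L < x) && p x).

Definition apery2 (L : seq nat) (n : nat) : seq nat :=
  [seq findmod L n a | a <- iota 0 n].

(* Main.v *)
Require Import Defs.
From mathcomp Require Import all_boot finmap.
From mathcomp Require Import boolp classical_sets functions cardinality.

Local Open Scope classical_set_scope.
Local Open Scope nat_scope.

(** Both sides describe the elements of [M] that are least in their residue
    class modulo [n].  Every number from the conductor on lies in [M], so
    [findmod] finds the least element of [M] in the class; and since [M] is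
    closed under adding [n], an element [x] of [M] is least in its class as
    soon as [x - n] is not in [M]. *)

Lemma sorted_nth_find_leq (p : pred nat) (s : seq nat) (y : nat) :
  sorted leq s -> y \in s -> p y -> nth 0 s (find p s) <= y.
Proof.
elim: s => [//|z s IHs] /= zs; rewrite inE => /orP[/eqP ->|ys] py.
  by rewrite py.
case: ifP => _ /=; last by apply: IHs => //; exact: path_sorted zs.
by move: zs; rewrite (path_sortedE leq_trans) => /andP[/allP /(_ y ys)].
Qed.

Lemma least_natP {P : pred nat} {m : nat} :
  P m -> P (least_nat P) /\ least_nat P <= m.
Proof.
move=> Pm; rewrite /least_nat; case: pselect => [exP|[]]; last by exists m.
by case: ex_minnP => k Pk /(_ m Pm).
Qed.

Lemma modn_eq_addM {n x y : nat} :
  y <= x -> x = y %[mod n] -> exists k, x = y + k * n.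
Proof.
move=> yx /eqP; rewrite eqn_mod_dvd // => /dvdnP[k xyE].
by exists k; rewrite -xyE subnKC.
Qed.

Lemma numerical_semigroupMn {M : set nat} {n : nat} (k : nat) {y : nat} :
  numerical_semigroup M -> M n -> M y -> M (y + k * n).
Proof.
move=> [_ MD _] Mn My; elim: k => [|k IHk]; first by rewrite mul0n addn0.
by rewrite mulSn addnCA; exact: MD.
Qed.

(** By contraposition: a number outside [M] is a gap, so it is at most the largest gap, which the
    successor in [conductor] puts strictly below the conductor. *)
Lemma ge_conductor {M : set nat} {x : nat} :
  numerical_semigroup M -> conductor M <= x -> M x.
Proof.
move=> [_ _ finC]; apply: contraPP => Mx.
have xgap : x \in gaps M by rewrite in_fset_set // inE.
rewrite /conductor ifF.
  by apply/negP; rewrite -leqNgt (@leq_bigmax_seq _ _ _ id).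
by apply/eqP => gaps0; rewrite gaps0 inE in xgap.
Qed.

Lemma mem_small_elements (M : set nat) (x : nat) :
  reflect (M x /\ x <= conductor M) (x \in small_elements M).
Proof.
rewrite /small_elements mem_filter mem_iota add0n ltnS.
by apply: (iffP andP) => -[]; rewrite inE.
Qed.

(** The conductor itself lies in [M], so the filter keeps the final entry of the [iota]. *)
Lemma last_small_elements (M : set nat) :
  numerical_semigroup M -> last 0 (small_elements M) = conductor M.
Proof.
move=> hM; rewrite /small_elements -[in iota _ _]addn1 iotaD filter_cat /=.
by rewrite add0n mem_set ?last_cat //; exact: ge_conductor hM _.
Qed.

(** If some small element lies in the class, the first one is least because the list is ascending
    and elements of [M] missing from it exceed the conductor. If none does, the search runs above
    the conductor, where every number lies in [M]. *)
Lemma findmod_small_elementsP {M : set nat} {n : nat} (a : nat) :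
  numerical_semigroup M -> 0 < n ->
  let w := findmod (small_elements M) n a in
  [/\ M w, w = a %[mod n] & forall y, M y -> y = a %[mod n] -> w <= y].
Proof.
move=> hM n0 /=; rewrite /findmod; case: ifPn => [hasL|/hasPn notL].
  have /mem_small_elements[Mw wc] :=
    mem_nth 0 (etrans (esym (has_find _ _)) hasL).
  have /eqP wa := nth_find 0 hasL; split=> // y My /eqP ya.
  have [yc|/ltnW cy] := leqP y (conductor M); last exact: leq_trans wc cy.
  apply: sorted_nth_find_leq => //; last exact/mem_small_elements.
  by apply: sorted_filter; [exact: leq_trans | exact: iota_sorted].
set Q := fun z => _ && _.
have QE z : Q z = (conductor M < z) && (z == a %[mod n]).
  by rewrite /Q last_small_elements.
(* Adding a multiple of [n] larger than the conductor gives a witness, so [least_nat] does not fall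
   back on its default 0. *)
have Qc : Q (a + (conductor M).+1 * n).
  by rewrite QE addnC modnMDl eqxx andbT ltn_addr // leq_pmulr.
have [+ _] := least_natP Qc; rewrite QE => /andP[cw /eqP wa].
split=> //; first exact: ge_conductor hM (ltnW cw).
(* At or below the conductor, [y] would be in the list, against [notL]. *)
move=> y My /eqP ya; suff Qy : Q y by exact: (least_natP Qy).2.
rewrite QE ya andbT ltnNge; apply: contraL ya => yc; apply: notL.
exact/mem_small_elements.
Qed.

Theorem theorem3 (M : set nat) (hM : numerical_semigroup M)
    (n : nat) (hnM : M n) (hn0 : n <> 0) (x : nat) :
  x \in apery2 (small_elements M) n <-> M x /\ (n <= x -> ~ M (x - n)).
Proof.
have n0 : 0 < n by rewrite lt0n; exact/eqP.
split=> [/mapP[a _ ->]|[Mx xnM]].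
  have [Mw wa wmin] := findmod_small_elementsP a hM n0; split=> // nw Mwn.
  (* Subtracting [n] keeps the residue class, so [Mwn] would give an element of [M] below the least
     one. *)
  have wna : findmod (small_elements M) n a - n = a %[mod n].
    by rewrite -wa -[in RHS](subnK nw) modnDr.
  have := wmin _ Mwn wna.
  by rewrite leqNgt ltn_subrL n0 (leq_trans n0 nw).
apply/mapP; exists (x %% n); first by rewrite mem_iota add0n ltn_mod n0.
have [Mw + wmin] := findmod_small_elementsP (x %% n) hM n0.
have := wmin x Mx (esym (modn_mod x n)); rewrite modn_mod.
set w := findmod _ _ _ in Mw * => wx /esym xw.
(* With a positive multiple of [n], [x - n] would be [w + k * n], which lies in [M]; hence [x] is
   [w]. *)
have [[|k] xE] := modn_eq_addM wx xw; first by rewrite xE mul0n addn0.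
case: xnM; first by rewrite xE mulSn addnCA leq_addr.
by rewrite xE mulSn addnCA addKn; exact: numerical_semigroupMn.
Qed.
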